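(* Let $\mathbb{F}$ be a field of characteristic not two, $\eta\in\mathbb{F}\setminus\{1,\frac12\}$, and let $A$ be a $\mathcal{PC}(\eta)$-axial algebra over $\mathbb{F}$. Suppose that $a$ and $b$ are primitive axes in $A$. Write $b=\alpha a+b_\eta+b_{1/2}$, where $b_\eta\in A_\eta(a)$, $b_{1/2}\in A_{1/2}(a)$, and $\alpha\in\mathbb{F}$. Then: (i) $b_\eta=\frac{1}{1-2\eta}(\alpha a+b-2ab)$ and $b_{1/2}=\frac{2}{1-2\eta}(\alpha(\eta-1)a-\eta b+ab)$; (ii) $a(ab)=\frac12\bigl((1-\eta)\alpha a-\eta b+(1+2\eta)ab\bigr)$; (iii) $(ab)^2=\frac14\Bigl(\bigl((1-\eta)(1-2\eta)\alpha-\eta(1+2\eta)\bigr)(a+b)+\bigl(2\alpha(1-\eta)(1+2\eta)+6\eta+4\eta^2\bigr)ab\Bigr)$; (iv) the projection of $a$ on $A_1(b)$ (along $A_\eta(b)\oplus A_{1/2}(b)$) equals $\alpha b$.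
   Context: Algebras are not assumed associative or unital. For a commutative $\mathbb{F}$-algebra $A$, $a\in A$ and $\lambda\in\mathbb{F}$, put $A_\lambda(a)=\{u\in A\mid au=\lambda u\}$. A ($\mathcal{PC}(\eta)$-)axis in $A$ is an idempotent $a\in A$ such that $A=A_1(a)\oplus A_\eta(a)\oplus A_{1/2}(a)$ and the fusion law $\mathcal{PC}(\eta)$ holds: $A_1(a)A_1(a)\subseteq A_1(a)$, $A_1(a)A_\eta(a)\subseteq A_\eta(a)$, $A_1(a)A_{1/2}(a)\subseteq A_{1/2}(a)$, $A_\eta(a)A_\eta(a)\subseteq A_1(a)$, $A_\eta(a)A_{1/2}(a)\subseteq A_{1/2}(a)$, $A_{1/2}(a)A_{1/2}(a)\subseteq A_1(a)\oplus A_\eta(a)$. An axis $a$ is primitive if $A_1(a)=\langle a\rangle$ is $1$-dimensional. A $\mathcal{PC}(\eta)$-axial algebra is a commutative $\mathbb{F}$-algebra generated by a set of axes. *)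

(* Defs.v *)
From mathcomp Require Import all_boot all_order all_algebra.
From mathcomp Require Import classical_sets.

Set Implicit Arguments.
Unset Strict Implicit.
Unset Printing Implicit Defensive.

Import GRing.Theory.
Local Open Scope classical_set_scope.
Local Open Scope ring_scope.

(* A not necessarily associative or unital F-algebra is an F-module [A] of
   arbitrary dimension with a bilinear product [mul]. *)
Section AxialAlgebras.
Variables (F : fieldType) (A : lmodType F).
Implicit Types (U V W X : set A) (eta lambda : F) (a x p : A).

Definition sumset U V : set A := [set u + v | u in U & v in V].

Definition direct_sum3 U V W : Prop :=
  forall x, exists! t : A * A * A,
    [/\ U t.1.1, V t.1.2, W t.2 & x = t.1.1 + t.1.2 + t.2].

(* [p] is the projection of [x] on [U] along [W]; such a [p] is unique when
   [U] and [W] are subspaces with direct sum [A]. *)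
Definition is_projection U W x p : Prop := U p /\ W (x - p).

Variable mul : {bilinear A -> A -> A}.

Definition prodset U V : set A := [set mul u v | u in U & v in V].

Definition axis_eigenspace a lambda : set A := [set u | mul a u = lambda *: u].

Definition subalgebra U : Prop :=
  [/\ U 0,
      forall u v, U u -> U v -> U (u + v),
      forall (c : F) u, U u -> U (c *: u)
    & forall u v, U u -> U v -> U (mul u v)].

Definition generates X : Prop := smallest subalgebra X = setT.

Definition fusion_law_PC eta a : Prop :=
  let A1 := axis_eigenspace a 1 in
  let Aeta := axis_eigenspace a eta in
  let Ahalf := axis_eigenspace a 2%:R^-1 in
  [/\ prodset A1 A1 `<=` A1,
      prodset A1 Aeta `<=` Aeta &
      prodset A1 Ahalf `<=` Ahalf] /\
  [/\ prodset Aeta Aeta `<=` A1,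
      prodset Aeta Ahalf `<=` Ahalf &
      prodset Ahalf Ahalf `<=` sumset A1 Aeta].

Definition PC_axis eta a : Prop :=
  [/\ mul a a = a,
      direct_sum3 (axis_eigenspace a 1) (axis_eigenspace a eta) (axis_eigenspace a 2%:R^-1)
    & fusion_law_PC eta a].

Definition primitive_PC_axis eta a : Prop :=
  [/\ PC_axis eta a, a != 0 & axis_eigenspace a 1 = range (fun c : F => c *: a)].

Definition PC_axial_algebra eta : Prop :=
  commutative mul /\
  exists X : set A, X `<=` PC_axis eta /\ generates X.

End AxialAlgebras.

(* Main.v *)
Require Import Defs.
From mathcomp Require Import all_boot all_order all_algebra.
From mathcomp Require Import classical_sets.
From mathcomp Require Import ring.

Import GRing.Theory.
Local Open Scope ring_scope.

(* Write b = alpha a + x + y along the eigenspaces of a.  The fusion law and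
   b^2 = b give x^2 = p a, 2xy = (1 - alpha) y, y^2 = q a + (1 - 2 alpha eta) x,
   so products in the span of a, x, y are determined by alpha and p.
   By (ii) for the axis b, b(ba) is a combination of a, b, ab with coefficients
   depending on the coefficient beta of a along b; comparing it with b(ba)
   computed in terms of a, x, y yields alpha = beta, the value of p, and
   (alpha - 1)(eta + 1) x = 0, whence (iii) and (iv). *)

(** * Coordinates with respect to three vectors *)

Section Comb3.
Variables (F : fieldType) (A : lmodType F) (u v w : A).

(** Keeping the three scalars as arguments reduces an identity between vectors, by [congr], to three
    scalar identities that [field] or [ring] decides. *)
Definition comb3 (r s t : F) : A := r *: u + s *: v + t *: w.

Lemma comb3D r s t r' s' t' :
  comb3 r s t + comb3 r' s' t' = comb3 (r + r') (s + s') (t + t').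
Proof. by rewrite /comb3 !scalerDl addrACA [X in X + _]addrACA. Qed.

Lemma comb3Z k r s t : k *: comb3 r s t = comb3 (k * r) (k * s) (k * t).
Proof. by rewrite /comb3 !scalerDr !scalerA. Qed.

Lemma comb3N r s t : - comb3 r s t = comb3 (- r) (- s) (- t).
Proof. by rewrite /comb3 !opprD !scaleNr. Qed.

Lemma comb3_1 : u = comb3 1 0 0.
Proof. by rewrite /comb3 scale1r !scale0r !addr0. Qed.

Lemma comb3_2 : v = comb3 0 1 0.
Proof. by rewrite /comb3 scale1r !scale0r addr0 add0r. Qed.

Lemma comb3_3 : w = comb3 0 0 1.
Proof. by rewrite /comb3 scale1r !scale0r !add0r. Qed.

Definition comb3E := (comb3N, comb3Z, comb3D).

End Comb3.

Arguments comb3 {F A} u v w r s t.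

Lemma comb3_comb3 (F : fieldType) (A : lmodType F) (u v w : A)
    r1 s1 t1 r2 s2 t2 r3 s3 t3 r s t :
  comb3 (comb3 u v w r1 s1 t1) (comb3 u v w r2 s2 t2) (comb3 u v w r3 s3 t3)
    r s t =
  comb3 u v w (r * r1 + s * r2 + t * r3) (r * s1 + s * s2 + t * s3)
    (r * t1 + s * t2 + t * t3).
Proof. by rewrite {1}/comb3 !comb3Z !comb3D. Qed.

(** * Bilinear products and eigenspaces *)

Section Bilinear.
Variables (F : fieldType) (A : lmodType F) (mul : {bilinear A -> A -> A}).

Lemma mul_comb3r u v w z (r s t : F) :
  mul z (comb3 u v w r s t) = comb3 (mul z u) (mul z v) (mul z w) r s t.
Proof. by rewrite /comb3 !linearD !linearZ. Qed.

Lemma mul_comb3l u v w z (r s t : F) :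
  mul (comb3 u v w r s t) z = comb3 (mul u z) (mul v z) (mul w z) r s t.
Proof. by rewrite /comb3 !linearDl !linearZl_LR. Qed.

Lemma axis_eigenspace0 a l : axis_eigenspace mul a l 0.
Proof. by rewrite /axis_eigenspace /= linear0 scaler0. Qed.

Lemma axis_eigenspaceZ a l k u :
  axis_eigenspace mul a l u -> axis_eigenspace mul a l (k *: u).
Proof.
by rewrite /axis_eigenspace /= linearZ /= => ->; rewrite !scalerA mulrC.
Qed.

Lemma axis_eigenspaceD a l u v : axis_eigenspace mul a l u ->
  axis_eigenspace mul a l v -> axis_eigenspace mul a l (u + v).
Proof.
by move=> uP vP; rewrite /axis_eigenspace /= linearDr uP vP scalerDr.
Qed.

Lemma direct_sum3_axis_eq0 a l1 l2 l3 u v w :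
  direct_sum3 (axis_eigenspace mul a l1) (axis_eigenspace mul a l2)
    (axis_eigenspace mul a l3) ->
  axis_eigenspace mul a l1 u -> axis_eigenspace mul a l2 v ->
  axis_eigenspace mul a l3 w -> u + v + w = 0 -> [/\ u = 0, v = 0 & w = 0].
Proof.
move=> /(_ 0) [t [_ tU]] hu hv hw e.
have e1 := tU (u, v, w) (And4 hu hv hw (esym e)).
have z0 := axis_eigenspace0 a.
have e2 : t = (0, 0, 0) by apply: tU; split; rewrite /= ?addr0 //.
by move: e1; rewrite e2 => -[<- <- <-].
Qed.

End Bilinear.

Arguments axis_eigenspaceZ {F A mul a l} k {u}.
Arguments axis_eigenspaceD {F A mul a l u v}.
Arguments direct_sum3_axis_eq0 {F A mul a l1 l2 l3 u v w}.

(** Certificate form: the cofactor [k] is supplied by hand, and [v = k * u] is left to [field]. *)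
Lemma eq0_of_mul (F : fieldType) (k u v : F) : u = 0 -> v = k * u -> v = 0.
Proof. by move=> -> ->; rewrite mulr0. Qed.
Arguments eq0_of_mul {F} k {u v}.

Lemma eq0_of_scale (F : fieldType) (A : lmodType F) (k u v : F) (x : A) :
  u *: x = 0 -> v = k * u -> v *: x = 0.
Proof. by move=> ux0 ->; rewrite -scalerA ux0 scaler0. Qed.
Arguments eq0_of_scale {F A} k {u v x}.

(** * Multiplication on the span of [a], [x], [y] *)

Section TwoAxes.
Variables (F : fieldType) (eta : F).
Hypotheses (two_neq0 : 2%:R != 0 :> F) (eta_neq_half : 1 - 2%:R * eta != 0).
Variables (A : lmodType F) (mul : {bilinear A -> A -> A}).
Variables (a x y : A) (alpha : F).
Hypotheses (aa : mul a a = a) (ax : mul a x = eta *: x)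
  (ay : mul a y = 2%:R^-1 *: y).
Let b := alpha *: a + x + y.
Local Notation c3 := (comb3 a x y).

Let aE : a = c3 1 0 0. Proof. exact: comb3_1. Qed.
Let xE : x = c3 0 1 0. Proof. exact: comb3_2. Qed.
Let yE : y = c3 0 0 1. Proof. exact: comb3_3. Qed.
Let bE : b = c3 alpha 1 1. Proof. by rewrite /comb3 !scale1r. Qed.

Let mul_a r s t : mul a (c3 r s t) = c3 r (eta * s) (2%:R^-1 * t).
Proof.
rewrite mul_comb3r aa ax ay /comb3 !scalerA.
by rewrite [s * _]mulrC [t * _]mulrC.
Qed.

(** The vectors [b - alpha a = x + y] and [ab - alpha a = eta x + y/2] form a linear system in [x]
    and [y] with determinant [1/2 - eta]. *)
Lemma axis_decomp_eta :
  x = (1 / (1 - 2%:R * eta)) *: (alpha *: a + b - 2%:R *: mul a b).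
Proof.
rewrite bE mul_a [in LHS]xE [X in alpha *: X]aE !comb3E.
by congr comb3; field; rewrite ?two_neq0 ?eta_neq_half.
Qed.

Lemma axis_decomp_half :
  y = (2%:R / (1 - 2%:R * eta)) *:
        ((alpha * (eta - 1)) *: a - eta *: b + mul a b).
Proof.
rewrite bE mul_a [in LHS]yE [X in (alpha * _) *: X]aE !comb3E.
by congr comb3; field; rewrite ?two_neq0 ?eta_neq_half.
Qed.

(** With [L] the multiplication by [a], the operator [(L - eta)(L - 1/2)] kills [x] and [y] and
    scales [a] by [(1 - eta)/2]. Apply it to [b] and expand. *)
Lemma axis_mul_mul : mul a (mul a b) =
  2%:R^-1 *: (((1 - eta) * alpha) *: a - eta *: b
              + (1 + 2%:R * eta) *: mul a b).
Proof.
rewrite bE !mul_a [X in (_ * alpha) *: X]aE !comb3E.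
by congr comb3; field; rewrite ?two_neq0.
Qed.

Hypothesis mulC : commutative mul.
Hypothesis indep : forall r s t : F,
  c3 r s t = 0 -> [/\ r = 0, s *: x = 0 & t *: y = 0].
Hypothesis b_neq0 : b != 0.
Variables p q : F.
Hypotheses (xx : mul x x = p *: a)
  (xy : mul x y = ((1 - alpha) / 2%:R) *: y)
  (yy : mul y y = q *: a + (1 - 2%:R * alpha * eta) *: x)
  (pq : alpha ^+ 2 + p + q = alpha).

Let mul_c3 r s t r' s' t' : mul (c3 r s t) (c3 r' s' t') =
  c3 (r * r' + p * s * s' + q * t * t')
     (eta * (r * s' + s * r') + (1 - 2%:R * alpha * eta) * t * t')
     (2%:R^-1 * (r * t' + t * r') + (1 - alpha) / 2%:R * (s * t' + t * s')).
Proof.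
have xxE : mul x x = c3 p 0 0 by rewrite xx /comb3 !scale0r !addr0.
have xyE : mul x y = c3 0 0 ((1 - alpha) / 2%:R).
  by rewrite xy /comb3 !scale0r !add0r.
have yyE : mul y y = c3 q (1 - 2%:R * alpha * eta) 0.
  by rewrite yy /comb3 scale0r addr0.
have xaE : mul x a = c3 0 eta 0.
  by rewrite mulC ax /comb3 !scale0r add0r addr0.
have yaE : mul y a = c3 0 0 2%:R^-1.
  by rewrite mulC ay /comb3 !scale0r !add0r.
rewrite mul_comb3l mul_a !mul_comb3r (mulC y x) xxE xyE yyE xaE yaE.
rewrite !comb3_comb3.
by congr comb3; field; rewrite ?two_neq0.
Qed.

(** Since [x] or [y] may be zero, only the coefficients of [a] can be equated as scalars. *)
Let comb3_inj r s t r' s' t' : c3 r s t = c3 r' s' t' ->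
  [/\ r = r', (s - s') *: x = 0 & (t - t') *: y = 0].
Proof.
move/eqP; rewrite -subr_eq0 !comb3E => /eqP /indep [/eqP].
by rewrite subr_eq0 => /eqP.
Qed.

Variable beta : F.
Hypothesis eta_neq1 : 1 - eta != 0.
Hypothesis b_mul_mul : mul b (mul b a) =
  2%:R^-1 *: (((1 - eta) * beta) *: b - eta *: a
              + (1 + 2%:R * eta) *: mul b a).

Lemma axis_structure_constants :
  [/\ beta = alpha, (1 - 2%:R * eta) * p = eta * (alpha - 1) ^+ 2
    & ((alpha - 1) * (eta + 1)) *: x = 0].
Proof.
have baE : mul b a = c3 alpha eta 2%:R^-1.
  by rewrite mulC bE mul_a; congr comb3; ring.
have a_neq0 : a != 0.
  apply/eqP => a0; have [] := @indep 1 0 0; last by move/eqP; rewrite oner_eq0.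
  by rewrite /comb3 a0 scaler0 !scale0r !addr0.
have qE : q = alpha - alpha ^+ 2 - p by rewrite -{1}pq; ring.
move: b_mul_mul; rewrite baE bE mul_c3.
rewrite [X in eta *: X]aE !comb3E => /comb3_inj [/eqP + ex ey].
rewrite -subr_eq0 => /eqP ea.
(* The difference of the [y] coefficients in [ey] is [(1 - eta)(alpha - beta)/2], so a nonzero [y]
   gives [beta = alpha]. Then [ea] determines [p], and [ex] is the third claim up to the factor
   [-(1 - 2 eta)/2]. *)
have [y0|yn0] := eqVneq y 0; last first.
  move/eqP: ey; rewrite scaler_eq0 (negPf yn0) orbF => /eqP ey.
  have betaE : beta = alpha.
    apply/eqP; rewrite -subr_eq0 -(mulrI_eq0 _ (mulfI eta_neq1)).
    by apply/eqP/(eq0_of_mul (- 2%:R) ey); field.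
  split=> //; rewrite betaE in ea ex.
    apply/eqP; rewrite -subr_eq0; apply/eqP/(eq0_of_mul (- 2%:R) ea).
    by rewrite qE; field.
  apply: (scalerI eta_neq_half); rewrite scaler0 scalerA.
  by apply: (eq0_of_scale (- 2%:R) ex); field.
(* For [y = 0] the formula for [y^2] becomes a linear relation between [a] and [x]. *)
have [q0 yy0] : q = 0 /\ (1 - 2%:R * alpha * eta) *: x = 0.
  have [] := @indep q (1 - 2%:R * alpha * eta) 0; last by [].
  by rewrite /comb3 scale0r addr0 -yy y0 linear0l.
(* If [x] vanishes too, then [b] is a nonzero multiple of [a]; [pq], which now reads
   [alpha^2 = alpha], gives [alpha = 1], and [ea] gives [beta = 1]. *)
have [x0|xn0] := eqVneq x 0.
  have p0 : p = 0.
    move/eqP: xx; rewrite x0 linear0l eq_sym scaler_eq0 (negPf a_neq0) orbF.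
    by move/eqP.
  have alpha_neq0 : alpha != 0.
    by apply: contraNneq b_neq0 => a0; rewrite /b a0 x0 y0 scale0r !addr0.
  have alpha1 : alpha = 1.
    by apply: (mulfI alpha_neq0); rewrite mulr1 -[RHS]pq p0 q0; ring.
  rewrite alpha1 p0 q0 in ea *; split; [|by ring|by rewrite x0 scaler0].
  apply/eqP; rewrite -subr_eq0 -(mulrI_eq0 _ (mulfI eta_neq1)).
  by apply/eqP/(eq0_of_mul (- 2%:R) ea); field.
move/eqP: yy0; rewrite scaler_eq0 (negPf xn0) orbF => /eqP yy0.
move/eqP: ex; rewrite scaler_eq0 (negPf xn0) orbF => /eqP ex.
(* Here y = 0 and x != 0, which forces eta = -1 and alpha = beta = -1/2. *)
have eta_neq0 : eta != 0.
  apply/eqP => eta0; move/eqP: yy0.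
  by rewrite eta0 mulr0 subr0 oner_eq0.
(* Since [x] is nonzero, its scalar factors in [yy0] and [ex] vanish; they give [alpha] and then
   [beta] as functions of [eta]. *)
have alphaE : alpha = (2%:R * eta)^-1.
  apply/eqP; rewrite -subr_eq0; apply/eqP.
  apply: (eq0_of_mul (- (2%:R * eta)^-1) yy0); field.
  by rewrite eta_neq0 two_neq0.
have betaE : beta = (1 - 2%:R * eta ^+ 2) / (1 - eta).
  apply/eqP; rewrite -subr_eq0; apply/eqP.
  apply: (eq0_of_mul (- 2%:R / (1 - eta)) ex); rewrite alphaE; field.
  by rewrite two_neq0 eta_neq1 eta_neq0.
have pE : p = alpha - alpha ^+ 2 by rewrite -{1}pq q0; ring.
(* After these substitutions, [4 eta^2] times the left side of [ea] is [4 eta^3 - 3 eta + 1], which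
   factors as below. *)
have etaN1 : eta = - 1.
  have /eqP : (eta + 1) * (1 - 2%:R * eta) ^+ 2 = 0.
    apply: (eq0_of_mul (4%:R * eta ^+ 2) ea); rewrite q0 pE betaE alphaE; field.
    by rewrite two_neq0 eta_neq1 eta_neq0.
  rewrite mulf_eq0 expf_eq0 (negPf eta_neq_half) andbF orbF addr_eq0.
  by move/eqP.
rewrite betaE pE alphaE etaN1; split; last by rewrite addNr mulr0 scale0r.
  by field; rewrite oppr_eq0 !two_neq0.
by field; rewrite oppr_eq0 !two_neq0.
Qed.

Lemma axis_mul_sqr : mul (mul a b) (mul a b) =
  4%:R^-1 *:
    (((1 - eta) * (1 - 2%:R * eta) * alpha
        - eta * (1 + 2%:R * eta)) *: (a + b)
     + (2%:R * alpha * (1 - eta) * (1 + 2%:R * eta)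
        + 6%:R * eta + 4%:R * eta ^+ 2) *: mul a b).
Proof.
have [_ ep ex] := axis_structure_constants.
have qE : q = alpha - alpha ^+ 2 - p by rewrite -{1}pq; ring.
have four_neq0 : 4%:R != 0 :> F by rewrite (natrM _ 2 2) mulf_neq0.
rewrite bE mul_a mul_c3 [X in X + c3 _ _ _]aE !comb3E.
apply/eqP; rewrite -subr_eq0 !comb3E.
set r := (X in c3 X _ _); set s := (X in c3 _ X _); set t := (X in c3 _ _ X).
(* The [a] coefficient vanishes by the value of [p], the [y] coefficient identically. The [x]
   coefficient may be nonzero, but it is a multiple of [(alpha - 1)(eta + 1)], which kills [x]. *)
have -> : r = 0.
  move/eqP: ep; rewrite -subr_eq0 => /eqP ep.
  apply: (eq0_of_mul (- (1 + 2%:R * eta) / 4%:R) ep).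
  by rewrite /r qE; field; rewrite ?four_neq0 ?two_neq0.
have -> : s = - ((1 - 4%:R * eta ^+ 2) / 4%:R) * ((alpha - 1) * (eta + 1)).
  by rewrite /s; field; rewrite ?four_neq0 ?two_neq0.
have -> : t = 0 by rewrite /t; field; rewrite ?four_neq0 ?two_neq0.
by rewrite /comb3 -scalerA ex !scale0r scaler0 !addr0.
Qed.

End TwoAxes.

(** * Consequences of primitivity and the fusion law *)

Section PrimitiveAxis.
Variables (F : fieldType) (eta : F) (A : lmodType F).
Variable mul : {bilinear A -> A -> A}.
Hypothesis two_neq0 : 2%:R != 0 :> F.
Hypothesis mulC : commutative mul.
Variable a : A.
Hypothesis prim_a : primitive_PC_axis mul eta a.
Variables (x y : A).
Hypotheses (xP : axis_eigenspace mul a eta x)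
  (yP : axis_eigenspace mul a 2%:R^-1 y).

Lemma primitive_axis_eigen1 : axis_eigenspace mul a 1 a.
Proof.
by case: prim_a => -[aa _ _] _ _; rewrite /axis_eigenspace /= scale1r.
Qed.

Lemma primitive_axis_indep (r s t : F) :
  comb3 a x y r s t = 0 -> [/\ r = 0, s *: x = 0 & t *: y = 0].
Proof.
have [[_ dsum _] a_neq0 _] := prim_a => /(direct_sum3_axis_eq0 dsum).
case; try exact: axis_eigenspaceZ.
  exact/axis_eigenspaceZ/primitive_axis_eigen1.
by move=> /eqP; rewrite scaler_eq0 (negPf a_neq0) orbF => /eqP.
Qed.

(** The fusion law and primitivity put [x^2] in the line of [a], [xy] in the [1/2]-eigenspace and
    [y^2] in [q a + z] with [z] in the [eta]-eigenspace. The components of [b^2 = b] then determine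
    [xy] and [z], and relate [p] to [q]. *)
Lemma primitive_axis_products (alpha : F) (b := alpha *: a + x + y) :
  mul b b = b ->
  exists p q : F, [/\ mul x x = p *: a,
    mul x y = ((1 - alpha) / 2%:R) *: y,
    mul y y = q *: a + (1 - 2%:R * alpha * eta) *: x
    & alpha ^+ 2 + p + q = alpha].
Proof.
move=> bb; have [[aa dsum [[_ _ _] [f1 f2 f3]]] a_neq0 A1E] := prim_a.
have [p _ xx] : range (fun c : F => c *: a) (mul x x).
  by rewrite -A1E; apply: f1; exists x => //; exists x.
have wP : axis_eigenspace mul a 2%:R^-1 (mul x y).
  by apply: f2; exists x => //; exists y.
have [u uP [z zP yy]] : sumset (axis_eigenspace mul a 1)
    (axis_eigenspace mul a eta) (mul y y).
  by apply: f3; exists y => //; exists y.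
move: uP; rewrite A1E => -[q _ uE]; rewrite -{u}uE in yy.
set w := mul x y in wP *.
have mul_ab : mul a b = comb3 a x y alpha (eta * 1) (2%:R^-1 * 1).
  by rewrite /b !linearD linearZ /= aa xP yP /comb3 !mulr1.
have mul_xb : mul x b = comb3 a x y p (alpha * eta) 0 + w.
  rewrite /b !linearD linearZ /= (mulC x a) xP -xx scalerA /comb3 scale0r addr0.
  by rewrite [p *: a + _]addrC.
have mul_yb : mul y b = comb3 a x y q 0 (alpha * 2%:R^-1) + (w + z).
  rewrite /b !linearD linearZ /= (mulC y a) (mulC y x) yP -yy scalerA.
  by rewrite /comb3 scale0r addr0 addrACA [q *: a + _]addrC.
have mul_bl v : mul b v = alpha *: mul a v + mul x v + mul y v.
  by rewrite /b 2!linearDl linearZl_LR.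
have regroup (c1 c2 c3 c4 v1 v2 : A) :
    c1 + (c2 + v1) + (c3 + v2) - c4 = c1 + c2 + c3 - c4 + (v1 + v2).
  by rewrite (addrA c1) (addrACA _ v1) [LHS]addrAC.
(* This is [b^2 - b = 0]: [w] occurs twice, as [xy] and [yx], and belongs with [y], while [z]
   belongs with [x]. *)
have e : comb3 a x y (alpha ^+ 2 + p + q - alpha) (2%:R * alpha * eta - 1)
    (alpha - 1) + (w + (w + z)) = 0.
  rewrite -[RHS](subrr b) -[X in _ = X - _]bb.
  rewrite mul_bl mul_ab mul_xb mul_yb.
  have -> : b = comb3 a x y alpha 1 1 by rewrite /comb3 !scale1r.
  rewrite regroup !comb3E.
  by congr (comb3 _ _ _ _ _ _ + _); field.
have [] := direct_sum3_axis_eq0 dsum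
  (axis_eigenspaceZ (alpha ^+ 2 + p + q - alpha) primitive_axis_eigen1)
  (axis_eigenspaceD (axis_eigenspaceZ (2%:R * alpha * eta - 1) xP) zP)
  (axis_eigenspaceD (axis_eigenspaceZ (alpha - 1) yP) (axis_eigenspaceD wP wP)).
  by rewrite -[RHS]e (addrA (_ *: a)) (addrACA _ z) (addrC z) -(addrA w).
move=> /eqP; rewrite scaler_eq0 (negPf a_neq0) orbF subr_eq0 => /eqP pq.
rewrite addrC => /addr0_eq zE; rewrite addrC => /addr0_eq wE.
exists p, q; split=> //.
  have -> : w = 2%:R^-1 *: (w + w).
    by rewrite -mulr2n -scaler_nat scalerA mulVf ?scale1r.
  rewrite -[w + w]opprK wE -scaleNr scalerA opprB; congr (_ *: _); ring.
by rewrite -yy -[z]opprK zE -scaleNr opprB.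
Qed.

End PrimitiveAxis.

Lemma primitive_axis_decomp (F : fieldType) (eta : F) (A : lmodType F)
    (mul : {bilinear A -> A -> A}) (a x : A) :
  primitive_PC_axis mul eta a ->
  exists (c : F) (u v : A),
    [/\ axis_eigenspace mul a eta u, axis_eigenspace mul a 2%:R^-1 v
      & x = c *: a + u + v].
Proof.
case=> -[_ dsum _] _ A1E; have [[[u1 u] v] [[/= u1P uP vP xE] _]] := dsum x.
by move: u1P xE; rewrite A1E => -[c _ <-] xE; exists c, u, v.
Qed.

Arguments axis_mul_mul {F eta} two_neq0 {A mul a x y} alpha.
Arguments axis_structure_constants {F eta} two_neq0 eta_neq_half
  {A mul a x y alpha} aa ax ay mulC indep b_neq0 {p q} xx xy yy pq {beta}.
Arguments axis_mul_sqr {F eta} two_neq0 eta_neq_half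
  {A mul a x y alpha} aa ax ay mulC indep b_neq0 {p q} xx xy yy pq {beta}.
Arguments primitive_axis_eigen1 {F eta A mul a}.
Arguments primitive_axis_indep {F eta A mul a} prim_a {x y} xP yP {r s t}.
Arguments primitive_axis_products {F eta A mul} two_neq0 mulC {a} prim_a
  {x y} xP yP alpha.
Arguments primitive_axis_decomp {F eta A mul a} x.

Theorem proposition1 (F : fieldType) (charF : 2%N \notin [pchar F])
    (eta : F) (eta_neq1 : eta != 1) (eta_neq_half : eta != 2%:R^-1)
    (A : lmodType F) (mul : {bilinear A -> A -> A})
    (axialA : PC_axial_algebra mul eta)
    (a b : A) (prim_a : primitive_PC_axis mul eta a)
    (prim_b : primitive_PC_axis mul eta b)
    (alpha : F) (b_eta b_half : A)
    (b_etaP : axis_eigenspace mul a eta b_eta)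
    (b_halfP : axis_eigenspace mul a 2%:R^-1 b_half)
    (bE : b = alpha *: a + b_eta + b_half) :
  [/\ b_eta = (1 / (1 - 2%:R * eta)) *:
                (alpha *: a + b - 2%:R *: mul a b) /\
      b_half = (2%:R / (1 - 2%:R * eta)) *:
                 ((alpha * (eta - 1)) *: a - eta *: b + mul a b),
      mul a (mul a b) =
        2%:R^-1 *: (((1 - eta) * alpha) *: a - eta *: b
                    + (1 + 2%:R * eta) *: mul a b),
      mul (mul a b) (mul a b) =
        4%:R^-1 *:
          (((1 - eta) * (1 - 2%:R * eta) * alpha
              - eta * (1 + 2%:R * eta)) *: (a + b)
           + (2%:R * alpha * (1 - eta) * (1 + 2%:R * eta)
              + 6%:R * eta + 4%:R * eta ^+ 2) *: mul a b)
    & is_projection (axis_eigenspace mul b 1)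
        (sumset (axis_eigenspace mul b eta) (axis_eigenspace mul b 2%:R^-1))
        a (alpha *: b)].
Proof.
have two_neq0 : 2%:R != 0 :> F by apply: contra charF => two0; rewrite inE.
have eta2 : 1 - 2%:R * eta != 0.
  apply: contra eta_neq_half; rewrite subr_eq0 => /eqP e.
  by apply/eqP/(mulfI two_neq0); rewrite -e divff.
have eta1 : 1 - eta != 0 by rewrite subr_eq0 eq_sym.
have [mulC _] := axialA.
have [[aa _ _] _ _] := prim_a; have [[bb _ _] b_neq0 _] := prim_b.
have [beta [a_eta [a_half [a_etaP a_halfP aE]]]] :=
  primitive_axis_decomp a prim_b.
(* This is (ii) with the axes exchanged; [beta] is the coefficient of [a] along [b]. *)
have b_mul_mul := axis_mul_mul two_neq0 beta bb a_etaP a_halfP.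
rewrite -aE in b_mul_mul.
have [|p [q [xx xy yy pq]]] := primitive_axis_products two_neq0 mulC prim_a
  b_etaP b_halfP alpha; first by rewrite -bE.
have indep := primitive_axis_indep prim_a b_etaP b_halfP.
rewrite bE in b_neq0 b_mul_mul.
have [betaE _ _] := axis_structure_constants two_neq0 eta2 aa b_etaP b_halfP
  mulC indep b_neq0 xx xy yy pq eta1 b_mul_mul.
split.
- rewrite [X in mul a X]bE [X in _ + X - _]bE [X in eta *: X]bE; split.
    exact: axis_decomp_eta.
  exact: axis_decomp_half.
- by rewrite bE; exact: axis_mul_mul.
- rewrite bE.
  exact: (axis_mul_sqr two_neq0 eta2 aa b_etaP b_halfP
    mulC indep b_neq0 xx xy yy pq eta1 b_mul_mul).
- split; first exact/axis_eigenspaceZ/(primitive_axis_eigen1 prim_b).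
  (* As [beta = alpha], the remainder [a - alpha b] is the sum of the other two components of [a]
     along [b]. *)
  exists a_eta => //; exists a_half => //.
  by rewrite {1}aE betaE -(addrA _ a_eta) [RHS]addrC addKr.
Qed.
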